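(* Let $k\in\mathbb{N}$, $k\ge 1$. The formula $$(v',z')\cdot(t,v,z)=\Bigl(t,\;v-R(t)v',\;z-z'-\tfrac12\, v^{T}JR(t)v'\Bigr),\qquad (v',z')\in \mathrm{H}_3(\mathbb{R}),\ (t,v,z)\in N,$$ where $$R(t)=\begin{pmatrix}\cos t&-\sin t\\ \sin t&\cos t\end{pmatrix},\qquad J=\begin{pmatrix}0&1\\-1&0\end{pmatrix},$$ defines an action of $\mathrm{H}_3(\mathbb{R})$ on $N$, and this action induces an isometric action of $\mathrm{H}_3(\mathbb{R})$ on the compact nilmanifold $\Lambda_k\backslash N$ (with the metric induced by $g$).
   Context: $\mathrm{H}_3(\mathbb{R})$ is the Heisenberg group: $\mathbb{R}^3$ with product $(x,y,z)(x',y',z')=(x+x',y+y',z+z'+\frac12(xy'-x'y))$. Its elements are written $(v,z)$ with $v=(x,y)\in\mathbb{R}^2$, $z\in\mathbb{R}$. $N=\mathbb{R}\times \mathrm{H}_3(\mathbb{R})$ is the direct product Lie group, modeled on $\mathbb{R}^4$ with coordinates $(t,v,z)=(t,x,y,z)$, so that its product is $(t_1,v_1,z_1)(t_2,v_2,z_2)=(t_1+t_2,v_1+v_2,z_1+z_2+\frac12 v_1^{T}Jv_2)$. It carries the left-invariant Lorentzian metric $$g=dt\,(dz+\tfrac12 y\,dx-\tfrac12 x\,dy)+dx^2+dy^2,$$ i.e. the metric whose matrix in the basis $\partial_t,\partial_x,\partial_y,\partial_z$ at $(t,x,y,z)$ is $$\begin{pmatrix}0&\frac12y&-\frac12x&1\\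 \frac12y&1&0&0\\-\frac12x&0&1&0\\1&0&0&0\end{pmatrix}.$$ $\Lambda_k=2\pi\mathbb{Z}\times\Gamma_k$ is the lattice of $N$ with $\Gamma_k=\mathbb{Z}\times\mathbb{Z}\times\frac1{2k}\mathbb{Z}<\mathrm{H}_3(\mathbb{R})$. The quotient $\Lambda_k\backslash N$ (by left translations of $\Lambda_k$) carries the induced metric, also denoted $g$, for which the canonical projection $N\to\Lambda_k\backslash N$ is a local isometry. *)

(* Defs.v *)
From HB Require Import structures.
From mathcomp Require Import all_boot all_order all_algebra.
From mathcomp Require Import all_classical all_reals all_analysis.
From mathcomp Require Import ring.
Import Order.TTheory GRing.Theory Num.Theory.
Import numFieldNormedType.Exports.

Set Implicit Arguments.
Unset Strict Implicit.
Unset Printing Implicit Defensive.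

Local Open Scope classical_set_scope.
Local Open Scope ring_scope.

Section Smooth.
Context {R : realType} {V W : normedModType R}.

(* Meant for open [U]. *)
Fixpoint Ck_on (k : nat) (U : set V) (f : V -> W) : Prop :=
  if k is j.+1 then
    (forall x, U x -> differentiable f x) /\
    (forall v, Ck_on j U (fun x => 'D_v f x))
  else forall x, U x -> {for x, continuous f}.

Definition smooth_on (U : set V) (f : V -> W) := forall k, Ck_on k U f.

End Smooth.

(* [chart_map] is only relevant on [chart_dom], and [chart_inv] only on
   [chart_img]; elsewhere their values are arbitrary. *)
Record chart (R : realType) (X : Type) (n : nat) := Chart {
  chart_dom : set X;
  chart_map : X -> 'rV[R]_n;
  chart_inv : 'rV[R]_n -> X }.

Definition chart_img (R : realType) (X : Type) n (c : chart R X n) :=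
  chart_map c @` chart_dom c.

Definition is_chart (R : realType) (X : topologicalType) n (c : chart R X n) :=
  [/\ open (chart_dom c),
      open (chart_img c),
      forall x, chart_dom c x -> chart_inv c (chart_map c x) = x,
      {within chart_dom c, continuous (chart_map c)} &
      {within chart_img c, continuous (chart_inv c)}].

Section Maps.
Context {R : realType} {X Y : topologicalType} {n m : nat}.
Implicit Types (a : chart R X n) (b : chart R Y m) (F : X -> Y).

Definition local_expr a b F : 'rV[R]_n -> 'rV[R]_m :=
  chart_map b \o F \o chart_inv a.

Definition local_dom a b F : set 'rV[R]_n :=
  chart_map a @` (chart_dom a `&` F @^-1` chart_dom b).

Definition smooth_map (A : set (chart R X n)) (B : set (chart R Y m)) F :=
  continuous F /\
  forall a b, A a -> B b -> smooth_on (local_dom a b F) (local_expr a b F).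

End Maps.

(* The last clause is the smoothness of the transition maps. *)
Definition smooth_atlas (R : realType) (X : topologicalType) n
    (A : set (chart R X n)) :=
  [/\ forall a, A a -> is_chart a,
      forall x, exists2 a, A a & chart_dom a x &
      smooth_map A A id].

Definition diffeomorphism (R : realType) (X Y : topologicalType) n m
    (A : set (chart R X n)) (B : set (chart R Y m)) (F : X -> Y) :=
  exists F' : Y -> X,
    [/\ cancel F F', cancel F' F, smooth_map A B F & smooth_map B A F'].

Definition prod_chart (R : realType) (X Y : Type) n m
    (a : chart R X n) (b : chart R Y m) : chart R (X * Y) (n + m) :=
  Chart (chart_dom a `*` chart_dom b)
    (fun p => row_mx (chart_map a p.1) (chart_map b p.2))
    (fun u => (chart_inv a (lsubmx u), chart_inv b (rsubmx u))).

Definition prod_atlas (R : realType) (X Y : Type) n m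
    (A : set (chart R X n)) (B : set (chart R Y m)) :
    set (chart R (X * Y) (n + m)) :=
  [set prod_chart a b | a in A & b in B].

(* A field of bilinear forms on the tangent spaces: [g a x] is its Gram matrix
   at the point [x] in the coordinate basis of the chart [a]. *)
Definition tensor_field (R : realType) (X : Type) (n : nat) :=
  chart R X n -> X -> 'M[R]_n.

(* [F] pulls [h] back to [g].  Jacobians act on row vectors, from the right. *)
Definition preserves_metric (R : realType) (X Y : topologicalType) n m
    (A : set (chart R X n)) (g : tensor_field R X n)
    (B : set (chart R Y m)) (h : tensor_field R Y m) (F : X -> Y) :=
  forall a b x, A a -> B b -> chart_dom a x -> chart_dom b (F x) ->
    let D := 'J (local_expr a b F) (chart_map a x) in
    g a x = D *m h b (F x) *m D^T.

(* Symmetry of [G] follows. *)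
Definition lorentz_form (R : realType) n (G : 'M[R]_n) :=
  exists2 P, P \in unitmx &
    P *m G *m P^T = diag_mx (\row_i (if i == 0%N :> nat then -1 else 1)).

(* The last clause is the transformation rule under changes of charts. *)
Definition lorentz_metric (R : realType) (X : topologicalType) n
    (A : set (chart R X n)) (g : tensor_field R X n) :=
  [/\ forall a, A a ->
        smooth_on (chart_img a) (fun u => g a (chart_inv a u)),
      forall a x, A a -> chart_dom a x -> lorentz_form (g a x) &
      preserves_metric A g A g id].

(* Source and target have the same dimension and their metrics are meant to be
   nondegenerate, so that the differentials are linear isometries and such
   maps are local diffeomorphisms. *)
Definition is_local_isometry (R : realType) (X Y : topologicalType) n
    (A : set (chart R X n)) (g : tensor_field R X n)
    (B : set (chart R Y n)) (h : tensor_field R Y n) (F : X -> Y) :=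
  smooth_map A B F /\ preserves_metric A g B h F.

Definition is_isometry (R : realType) (X Y : topologicalType) n
    (A : set (chart R X n)) (g : tensor_field R X n)
    (B : set (chart R Y n)) (h : tensor_field R Y n) (F : X -> Y) :=
  diffeomorphism A B F /\ preserves_metric A g B h F.

Definition is_left_action (G : groupType) (X : Type) (a : G -> X -> X) :=
  (forall x, a 1%g x = x) /\ (forall g h x, a (g * h)%g x = a g (a h x)).

Definition mx_of_rows (R : realType) m n (s : seq (seq R)) : 'M[R]_(m, n) :=
  \matrix_(i, j) (nth [::] s i)`_j.

Definition heis (R : realType) := ('cV[R]_2 * R)%type.
HB.instance Definition _ (R : realType) :=
  Topological.copy (heis R) ('cV[R]_2 * R)%type.

Section Heisenberg.
Variable R : realType.

Definition heis_mul (h h' : heis R) : heis R :=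
  (h.1 + h'.1,
   h.2 + h'.2 + 2^-1 * (h.1 0 0 * h'.1 1 0 - h'.1 0 0 * h.1 1 0)).
Definition heis_one : heis R := (0, 0).
Definition heis_inv (h : heis R) : heis R := (- h.1, - h.2).

Fact heis_mulA : associative heis_mul.
Proof.
move=> [v1 z1] [v2 z2] [v3 z3]; congr pair => /=; first by rewrite addrA.
by rewrite !mxE; ring.
Qed.

Fact heis_mul1 : left_id heis_one heis_mul.
Proof.
by move=> [v z]; congr pair => /=; [rewrite add0r | rewrite !mxE; ring].
Qed.

Fact heis_mulr1 : right_id heis_one heis_mul.
Proof.
by move=> [v z]; congr pair => /=; [rewrite addr0 | rewrite !mxE; ring].
Qed.

Fact heis_mulV : left_inverse heis_one heis_inv heis_mul.
Proof.
by move=> [v z]; congr pair => /=; [rewrite addNr | rewrite !mxE; ring].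
Qed.

Fact heis_mulrV : right_inverse heis_one heis_inv heis_mul.
Proof.
by move=> [v z]; congr pair => /=; [rewrite addrN | rewrite !mxE; ring].
Qed.

End Heisenberg.

HB.instance Definition _ (R : realType) :=
  isGroup.Build (heis R) (@heis_mulA R) (@heis_mul1 R) (@heis_mulr1 R)
    (@heis_mulV R) (@heis_mulrV R).

Definition heis_chart (R : realType) : chart R (heis R) 3 :=
  Chart setT
    (fun h : heis R => \row_i [:: h.1 0 0; h.1 1 0; h.2]`_i)
    (fun u : 'rV[R]_3 => (mx_of_rows 2 1 [:: [:: u 0 0]; [:: u 0 1]], u 0 2)).

Definition heis_atlas (R : realType) : set (chart R (heis R) 3) :=
  [set heis_chart R].

Definition Rheis (R : realType) := (R * heis R)%type.
HB.instance Definition _ (R : realType) :=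
  Topological.copy (Rheis R) (R * heis R)%type.

Section RHeisenberg.
Variable R : realType.

Definition Rheis_mul (p q : Rheis R) : Rheis R := (p.1 + q.1, (p.2 * q.2)%g).
Definition Rheis_one : Rheis R := (0, 1%g).
Definition Rheis_inv (p : Rheis R) : Rheis R := (- p.1, (p.2^-1)%g).

Fact Rheis_mulA : associative Rheis_mul.
Proof. by move=> p q r; congr pair; rewrite ?addrA ?mulgA. Qed.

Fact Rheis_mul1 : left_id Rheis_one Rheis_mul.
Proof. by move=> [t h]; congr pair; rewrite ?add0r ?mul1g. Qed.

Fact Rheis_mulr1 : right_id Rheis_one Rheis_mul.
Proof. by move=> [t h]; congr pair; rewrite ?addr0 ?mulg1. Qed.

Fact Rheis_mulV : left_inverse Rheis_one Rheis_inv Rheis_mul.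
Proof. by move=> [t h]; congr pair; rewrite ?addNr ?mulVg. Qed.

Fact Rheis_mulrV : right_inverse Rheis_one Rheis_inv Rheis_mul.
Proof. by move=> [t h]; congr pair; rewrite ?addrN ?mulgV. Qed.

End RHeisenberg.

HB.instance Definition _ (R : realType) :=
  isGroup.Build (Rheis R) (@Rheis_mulA R) (@Rheis_mul1 R) (@Rheis_mulr1 R)
    (@Rheis_mulV R) (@Rheis_mulrV R).

Section LorentzianN.
Variable R : realType.

(* The coordinates (t, x, y, z). *)
Definition Rheis_coords (p : Rheis R) : 'rV[R]_4 :=
  \row_i [:: p.1; p.2.1 0 0; p.2.1 1 0; p.2.2]`_i.

Definition Rheis_point (u : 'rV[R]_4) : Rheis R :=
  (u 0 0, (mx_of_rows 2 1 [:: [:: u 0 1]; [:: u 0 2]], u 0 3)).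

Definition Rheis_atlas : set (chart R (Rheis R) 4) :=
  [set Chart setT Rheis_coords Rheis_point].

Definition gram (p : Rheis R) : 'M[R]_4 :=
  let x := p.2.1 0 0 in let y := p.2.1 1 0 in
  mx_of_rows 4 4
    [:: [:: 0;         2^-1 * y; - 2^-1 * x; 1];
        [:: 2^-1 * y;  1;        0;          0];
        [:: - 2^-1 * x; 0;       1;          0];
        [:: 1;         0;        0;          0]].

(* [Rheis_atlas] has a single chart, whence the ignored argument. *)
Definition Rheis_metric : tensor_field R (Rheis R) 4 := fun _ p => gram p.

Definition rotmx (t : R) : 'M[R]_2 :=
  mx_of_rows 2 2 [:: [:: cos t; - sin t]; [:: sin t; cos t]].

Definition Jmx : 'M[R]_2 := mx_of_rows 2 2 [:: [:: 0; 1]; [:: -1; 0]].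

Definition heis_act (h : heis R) (p : Rheis R) : Rheis R :=
  let: (v', z') := h in
  let: (t, (v, z)) := p in
  (t, (v - rotmx t *m v',
       z - z' - 2^-1 * (v^T *m Jmx *m rotmx t *m v') 0 0)).

Definition Gamma (k : nat) : set (heis R) :=
  [set h : heis R | exists a b c : int,
     [/\ h.1 0 0 = a%:~R, h.1 1 0 = b%:~R & h.2 = c%:~R / (2 * k)%:R]].

Definition Lambda (k : nat) : set (Rheis R) :=
  [set p : Rheis R | (exists m : int, p.1 = 2 * pi * m%:~R) /\ Gamma k p.2].

Definition Lambda_rel (k : nat) : rel (Rheis R) :=
  fun p q => `[< exists2 l, Lambda k l & q = (l * p)%g >].

Section LambdaEquiv.
Variables (k : nat) (hk : (0 < k)%N).

Fact Lambda1 : Lambda k 1%g.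
Proof.
split; first by exists 0; rewrite mulr0.
by exists 0, 0, 0; rewrite /= !mxE mul0r.
Qed.

Fact LambdaV l : Lambda k l -> Lambda k (l^-1)%g.
Proof.
move=> [[m lm] [a [b [c [la lb lc]]]]]; split => /=.
  by exists (- m); rewrite lm mulrNz mulrN.
by exists (- a), (- b), (- c); rewrite /= !mxE la lb lc !mulrNz mulNr.
Qed.

Fact LambdaM l l' : Lambda k l -> Lambda k l' -> Lambda k (l * l')%g.
Proof.
move=> [[m lm] [a [b [c [la lb lc]]]]] [[m' lm'] [a' [b' [c' [la' lb' lc']]]]].
split => /=.
  by exists (m + m'); rewrite lm lm' intrD [RHS]mulrDr.
exists (a + a'), (b + b'), (c + c' + k%:Z * (a * b' - a' * b)).
rewrite /= !mxE la lb lc la' lb' lc' !intrD !rmorphM /= rmorphB /= !rmorphM /=.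
split=> //; rewrite natrM.
by field; rewrite ?pnatr_eq0 ?(lt0n_neq0 hk).
Qed.

Fact Lambda_rel_refl : reflexive (Lambda_rel k).
Proof. by move=> p; apply/asboolP; exists 1%g; rewrite ?mul1g //; apply: Lambda1. Qed.

Fact Lambda_rel_sym : symmetric (Lambda_rel k).
Proof.
move=> p q; apply/asboolP/asboolP => -[l Ll ->];
by exists (l^-1)%g; rewrite ?mulKg //; exact: LambdaV.
Qed.

Fact Lambda_rel_trans : transitive (Lambda_rel k).
Proof.
move=> q p r /asboolP[l Ll ->] /asboolP[l' Ll' ->]; apply/asboolP.
by exists (l' * l)%g; rewrite ?mulgA //; exact: LambdaM.
Qed.

Definition Lambda_equiv : equiv_rel (Rheis R) :=
  EquivRel (Lambda_rel k) Lambda_rel_refl Lambda_rel_sym Lambda_rel_trans.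

Definition nilmanifold := quotient_topology {eq_quot Lambda_equiv}%qT.
HB.instance Definition _ := Topological.on nilmanifold.
HB.instance Definition _ := Quotient.on nilmanifold.

Definition nil_proj : Rheis R -> nilmanifold := \pi_nilmanifold%qT.

(* The charts are the continuous local sections of the projection with open
   image, read in the global coordinates of N. *)
Definition nil_atlas : set (chart R nilmanifold 4) :=
  [set c | is_chart c /\ chart_inv c = nil_proj \o Rheis_point].

Definition nil_metric : tensor_field R nilmanifold 4 :=
  fun c q => gram (Rheis_point (chart_map c q)).

End LambdaEquiv.
End LorentzianN.

Arguments heis_act {R} h p.
Arguments heis_atlas R : clear implicits.
Arguments Rheis_atlas R : clear implicits.
Arguments Rheis_metric R : clear implicits.
Arguments nilmanifold R {k} hk.
Arguments nil_proj R {k} hk p.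
Arguments nil_atlas R {k} hk.
Arguments nil_metric R {k} hk.

(* Main.v *)
Require Import Defs.
From HB Require Import structures.
From mathcomp Require Import all_boot all_order all_algebra.
From mathcomp Require Import all_classical all_reals all_analysis.
From mathcomp Require Import ring lra.
Import Order.TTheory GRing.Theory Num.Theory.
Import numFieldNormedType.Exports.

Set Implicit Arguments.
Unset Strict Implicit.
Unset Printing Implicit Defensive.

Local Open Scope classical_set_scope.
Local Open Scope ring_scope.

(* Left translations by Lambda commute with the action because the action does
   not move t and R(t) has period 2 pi; hence the action descends to the
   quotient.  In every pair of charts of the quotient, the projection, the
   induced maps and the changes of charts all read, locally, as
   u |-> l (h . u) in the coordinates of N, for a fixed l in Lambda.  So
   smoothness and invariance of the metric reduce to one computation, that of
   the Jacobian of this explicit map.  The quotient is compact because it is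
   the image of a box, Hausdorff because the projection is open and the orbit
   relation is closed, and it has charts because the projection is injective
   on small balls. *)

(** * Germs and smooth functions *)

Section Germs.
Context {R : realType} {V W : normedModType R}.
Implicit Types f g : V -> W.

(** The differential of [f] at [x] also serves [g]: near 0 the two first-order remainders coincide,
    and [diff_unique] then identifies it with ['d g x]. *)
Lemma near_eq_differentiable f g (x : V) :
  (\near x, f x = g x) -> differentiable f x -> differentiable g x.
Proof.
move=> fg df; have fgx : f x = g x := nbhs_singleton fg.
have cdf : continuous ('d f x) by exact: diff_continuous.
have H : g \o shift x = cst (g x) + 'd f x +o_ (0 : V) id.
  apply/eqaddoP => _/posnumP[e].
  have /eqaddoP/(_ _ (gt0 e)) dfe := diff_locally df.
  have fg0 : \forall y \near (0 : V), f (y + x) = g (y + x).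
    by move: fg; rewrite (near_shift 0) subr0.
  near=> y.
  have fgy : f (y + x) = g (y + x) by near: y.
  rewrite (_ : (g \o shift x - (cst (g x) + 'd f x)) y =
               (f \o shift x - (cst (f x) + 'd f x)) y); first by near: y.
  by rewrite !fctE /= fgx fgy.
have dgE := diff_unique cdf H.
by apply/diff_locallyP; split; rewrite dgE.
Unshelve. all: by end_near. Qed.

(** Smoothness depends only on germs. This is what allows chart expressions, known only locally, to
    be replaced by globally defined smooth maps. *)
Lemma smooth_on_local (U : set V) f :
  (forall x, U x -> exists2 g, smooth_on setT g & \near x, f x = g x) ->
  smooth_on U f.
Proof.
move=> H k; have {H} : forall x, U x ->
    exists2 g, Ck_on k setT g & \near x, f x = g x.
  by move=> x /H[g gs fg]; exists g.
elim: k f => [|k IH] f H /=.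
  move=> x /H[g gc fg]; have /= gx := gc x I.
  rewrite /prop_for /continuous_at (nbhs_singleton fg).
  by apply: cvg_trans gx; apply: near_eq_cvg; near do apply/esym.
split=> [x /H[g [gd _] fg]|v].
  have gf : \near x, g x = f x by near do apply/esym.
  exact: near_eq_differentiable gf (gd x I).
apply: IH => x /H[g [_ gd] fg]; exists (fun x => 'D_v g x); first exact: gd.
(* Equality near [x] is equality near every [y] close to [x], so the derivatives also agree near
   [x], and the induction hypothesis applies to them. *)
by apply: filterS (nbhs_interior fg) => y; exact: near_eq_derive.
Unshelve. all: by end_near. Qed.

End Germs.

(** For differentiable maps the Jacobian is determined by the directional derivatives, which depend
    only on the germ; basis vectors give its rows. *)
Lemma near_eq_jacobian (R : realType) m n (f g : 'rV[R]_m -> 'rV[R]_n) x :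
  (\near x, f x = g x) -> differentiable f x -> 'J g x = 'J f x.
Proof.
move=> fg df; have dg := near_eq_differentiable fg df.
have Jg v : 'D_v g x = v *m 'J g x by exact: deriveEjacobian.
have Jf v : 'D_v f x = v *m 'J f x by exact: deriveEjacobian.
have {Jg Jf} : forall v : 'rV_m, v *m 'J g x = v *m 'J f x.
  move=> v; transitivity ('D_v g x); first exact/esym/Jg.
  transitivity ('D_v f x); last exact: Jf.
  by apply/esym; exact: near_eq_derive.
move: ('J g x) ('J f x) => A B AB.
by apply/row_matrixP => i; rewrite !rowE.
Qed.

(** * Closure properties of functions of class C^k *)

Section SmoothCalculus.
Context {R : realType} {V : normedModType R}.

(** The Leibniz and chain rules keep undifferentiated factors, which the inductions below need at
    one order less. *)
Lemma Ck_onW {W : normedModType R} k (U : set V) (f : V -> W) :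
  Ck_on k.+1 U f -> Ck_on k U f.
Proof.
elim: k f => [|k IH] f [df Df]; first by move=> x /df/differentiable_continuous.
by split=> // v; apply: IH.
Qed.

Lemma Ck_cst {W : normedModType R} k (c : W) : Ck_on k setT (fun _ : V => c).
Proof.
elim: k c => [|k IH] c /=; first by move=> x _; exact: cst_continuous.
split=> [x _|v]; first exact: differentiable_cst.
by under eq_fun do rewrite derive_cst; exact: IH.
Qed.

Lemma CkD {W : normedModType R} k (f g : V -> W) :
  Ck_on k setT f -> Ck_on k setT g -> Ck_on k setT (fun x => f x + g x).
Proof.
elim: k f g => [|k IH] f g /=.
  by move=> cf cg x _; apply: continuousD; [exact: cf|exact: cg].
move=> [df Df] [dg Dg]; split=> [x _|v].
  by apply: differentiableD; [exact: df|exact: dg].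
rewrite (_ : (fun x => _) = (fun x => 'D_v f x + 'D_v g x)); first exact: IH.
apply/funext => x; apply: deriveD; apply: diff_derivable.
  exact: df.
exact: dg.
Qed.

Lemma CkM k (f g : V -> R) :
  Ck_on k setT f -> Ck_on k setT g -> Ck_on k setT (fun x => f x * g x).
Proof.
elim: k f g => [|k IH] f g.
  by move=> cf cg x _; apply: continuousM; [exact: cf|exact: cg].
move=> Cf Cg; have Cf' := Ck_onW Cf; have Cg' := Ck_onW Cg.
have [df Df] := Cf; have [dg Dg] := Cg; split=> [x _|v].
  by apply: differentiableM; [exact: df|exact: dg].
rewrite (_ : (fun x => _) = (fun x => f x * 'D_v g x + g x * 'D_v f x)).
  by apply: CkD; apply: IH => //; [exact: Dg|exact: Df].
apply/funext => x; apply: deriveM; apply: diff_derivable.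
  exact: df.
exact: dg.
Qed.

Lemma CkZl {W : normedModType R} k (f : V -> R) (w : W) :
  Ck_on k setT f -> Ck_on k setT (fun x => f x *: w).
Proof.
elim: k f => [|k IH] f /=.
  by move=> cf x _; apply: continuousZl; exact: cf.
move=> [df Df]; have dfw x : differentiable (fun x => f x *: w) x.
  by apply: differentiableZl; exact: df.
split=> [//|v].
rewrite (_ : (fun x => _) = (fun x => 'D_v f x *: w)); first exact: IH.
by apply/funext => x; rewrite !deriveE ?diffZl //; exact: df.
Qed.

Lemma derive_post (f : V -> R) (g : R -> R) (dg : R) x v :
  differentiable f x -> is_derive (f x) 1 g dg ->
  differentiable (g \o f) x /\ 'D_v (g \o f) x = dg * 'D_v f x.
Proof.
move=> df [dg1 dgE]; have /derivable1_diffP dg' := dg1.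
split; first exact: differentiable_comp.
rewrite !deriveE //; last exact: differentiable_comp.
(* The differential of [g] is linear on a line, so it is multiplication by its value at 1, namely
   [dg]. *)
rewrite diff_comp //= -[X in 'd g _ X]mulr1 [LHS]linearZ mulrC -dgE.
by rewrite deriveE.
Qed.

(** This rule and the next two spell out the pointwise operations, so that derivatives of explicit
    formulas can be assembled as terms. *)
Lemma is_derive_addf (f g : V -> R) df dg x v :
  is_derive x v f df -> is_derive x v g dg ->
  is_derive x v (fun w => f w + g w) (df + dg).
Proof. by move=> ? ?; exact: is_deriveD. Qed.

Lemma is_derive_oppf (f : V -> R) df x v :
  is_derive x v f df -> is_derive x v (fun w => - f w) (- df).
Proof. by move=> ?; exact: is_deriveN. Qed.

Lemma is_derive_mulf (f g : V -> R) df dg x v :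
  is_derive x v f df -> is_derive x v g dg ->
  is_derive x v (fun w => f w * g w) (f x * dg + g x * df).
Proof. by move=> ? ?; exact: is_deriveM. Qed.

(** Sine and cosine go through the induction together, since each is, up to sign, the derivative of
    the other. *)
Lemma Ck_sin_cos k (f : V -> R) : Ck_on k setT f ->
  Ck_on k setT (sin \o f) /\ Ck_on k setT (cos \o f).
Proof.
elim: k f => [|k IH] f.
  move=> cf; split=> x _; apply: continuous_comp; try exact: cf.
    exact: continuous_sin.
  exact: continuous_cos.
move=> Cf; have [Cs Cc] := IH _ (Ck_onW Cf); have [df Df] := Cf.
split; split=> [x _|v].
- by have [] := @derive_post f sin _ x 0 (df x I) (is_derive_sin _).
- rewrite (_ : (fun x => _) = (fun x => cos (f x) * 'D_v f x)).
    by apply: CkM => //; exact: Df.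
  apply/funext => x.
  by have [] := @derive_post f sin _ x v (df x I) (is_derive_sin _).
- by have [] := @derive_post f cos _ x 0 (df x I) (is_derive_cos _).
- rewrite (_ : (fun x => _) = (fun x => (-1 * sin (f x)) * 'D_v f x)).
    by apply: CkM; [apply: CkM => //; exact: Ck_cst|exact: Df].
  apply/funext => x; rewrite mulN1r.
  by have [] := @derive_post f cos _ x v (df x I) (is_derive_cos _).
Qed.

End SmoothCalculus.

Lemma Ck_coord {R : realType} k m n i j :
  Ck_on k setT (fun u : 'M[R]_(m, n) => u i j : R).
Proof.
case: k => [|k]; first by move=> x _; exact: coord_continuous.
split=> [x _|v]; first exact: differentiable_coord.
rewrite (_ : (fun x => _) = (fun=> v i j)); first exact: Ck_cst.
apply/funext => x.
have := derive_mx (@derivable_id R 'M[R]_(m, n) x v).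
by rewrite derive_id => /matrixP/(_ i j); rewrite mxE.
Qed.

Section SmoothMatrices.
Context {R : realType} {V : normedModType R}.

(** A matrix-valued map is the finite sum of its entries times the constant matrices
    [delta_mx i j]. *)
Lemma smooth_mx m n (f : V -> 'M[R]_(m, n)) :
  (forall i j, smooth_on setT (fun x => f x i j)) -> smooth_on setT f.
Proof.
move=> H k; rewrite (_ : f = fun x => \sum_i \sum_j f x i j *: delta_mx i j).
  have S (W : normedModType R) I (r : seq I) (h : I -> V -> W) :
      (forall i, Ck_on k setT (h i)) ->
      Ck_on k setT (fun x => \sum_(i <- r) h i x).
    move=> hC; elim: r => [|i r IH].
      by under eq_fun do rewrite big_nil; exact: Ck_cst.
    by under eq_fun do rewrite big_cons; apply: CkD.
  apply: (S) => i; apply: (S) => j.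
  exact/CkZl/H.
by apply/funext => x; rewrite -matrix_sum_delta.
Qed.

End SmoothMatrices.

(** * The action on N and its Jacobian *)

(** The cases are phrased with the numerals used for matrix entries, so that the coordinate formulas
    apply to them as they stand. *)
Lemma ord2_ind (P : 'I_2 -> Prop) : P 0 -> P 1 -> forall i, P i.
Proof.
move=> P0 P1 [[|[|//]] lti].
  by rewrite (_ : Ordinal lti = 0) //; exact: val_inj.
by rewrite (_ : Ordinal lti = 1) //; exact: val_inj.
Qed.

Lemma ord4_ind (P : 'I_4 -> Prop) : P 0 -> P 1 -> P 2 -> P 3 -> forall i, P i.
Proof.
move=> P0 P1 P2 P3 [[|[|[|[|//]]]] lti].
- by rewrite (_ : Ordinal lti = 0) //; exact: val_inj.
- by rewrite (_ : Ordinal lti = 1) //; exact: val_inj.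
- by rewrite (_ : Ordinal lti = 2) //; exact: val_inj.
- by rewrite (_ : Ordinal lti = 3) //; exact: val_inj.
Qed.

Lemma sum_ord2 (V : nmodType) (F : 'I_2 -> V) : \sum_i F i = F 0 + F 1.
Proof.
rewrite !big_ord_recl big_ord0 addr0; congr (_ + F _); exact: val_inj.
Qed.

Lemma sum_ord4 (V : nmodType) (F : 'I_4 -> V) :
  \sum_i F i = F 0 + F 1 + F 2 + F 3.
Proof.
rewrite !big_ord_recl big_ord0 addr0 !addrA.
by congr (_ + F _ + F _ + F _); exact: val_inj.
Qed.

Section HeisAct.
Context {R : realType}.
Implicit Types (g h : heis R) (p q l : Rheis R).

Lemma Rheis_coordsK : cancel (@Rheis_coords R) (@Rheis_point R).
Proof.
move=> [t [v z]]; congr (_, (_, _)); rewrite ?mxE //.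
by apply/colP; elim/ord2_ind; rewrite !mxE /= ?mxE.
Qed.

Lemma Rheis_pointK : cancel (@Rheis_point R) (@Rheis_coords R).
Proof. by move=> u; apply/rowP; elim/ord4_ind; rewrite !mxE /= ?mxE. Qed.

Lemma Rheis_coordsE p :
  [/\ Rheis_coords p 0 0 = p.1, Rheis_coords p 0 1 = p.2.1 0 0,
      Rheis_coords p 0 2 = p.2.1 1 0 & Rheis_coords p 0 3 = p.2.2].
Proof. by split; rewrite mxE. Qed.

Lemma heis_eq (h h' : heis R) :
  h.1 0 0 = h'.1 0 0 -> h.1 1 0 = h'.1 1 0 -> h.2 = h'.2 -> h = h'.
Proof.
case: h h' => [v z] [v' z'] /= e0 e1 ->; congr (_, _).
by apply/colP; elim/ord2_ind.
Qed.

Lemma Rheis_eq p q : p.1 = q.1 -> p.2.1 0 0 = q.2.1 0 0 ->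
  p.2.1 1 0 = q.2.1 1 0 -> p.2.2 = q.2.2 -> p = q.
Proof.
by case: p q => [t h] [t' h'] /= -> e0 e1 e2; congr (_, _); exact: heis_eq.
Qed.

(** [rot1 h t] and [rot2 h t] are the two coordinates of R(t)v', where v' is the planar part of
    [h]. *)
Definition rot1 h (t : R) := cos t * h.1 0 0 - sin t * h.1 1 0.

Definition rot2 h (t : R) := sin t * h.1 0 0 + cos t * h.1 1 0.

Lemma heis_act_tE h p : (heis_act h p).1 = p.1.
Proof. by case: h p => [v' z'] [t [v z]]. Qed.

Lemma heis_act_xE h p : (heis_act h p).2.1 0 0 = p.2.1 0 0 - rot1 h p.1.
Proof.
case: h p => [v' z'] [t [v z]] /=.
by rewrite /rot1 !mxE sum_ord2 /= !mxE /=; ring.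
Qed.

Lemma heis_act_yE h p : (heis_act h p).2.1 1 0 = p.2.1 1 0 - rot2 h p.1.
Proof.
case: h p => [v' z'] [t [v z]] /=.
by rewrite /rot2 !mxE sum_ord2 /= !mxE /=; ring.
Qed.

Lemma heis_act_zE h p : (heis_act h p).2.2 = p.2.2 - h.2
  - 2^-1 * (p.2.1 0 0 * rot2 h p.1 - p.2.1 1 0 * rot1 h p.1).
Proof.
case: h p => [v' z'] [t [v z]] /=; rewrite /rot1 /rot2.
by rewrite !(mxE, sum_ord2) /=; ring.
Qed.

Definition heis_actE :=
  (heis_act_tE, heis_act_xE, heis_act_yE, heis_act_zE).

Lemma Rheis_mulE l p : [/\ (l * p)%g.1 = l.1 + p.1,
  (l * p)%g.2.1 0 0 = l.2.1 0 0 + p.2.1 0 0,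
  (l * p)%g.2.1 1 0 = l.2.1 1 0 + p.2.1 1 0 &
  (l * p)%g.2.2 = l.2.2 + p.2.2
    + 2^-1 * (l.2.1 0 0 * p.2.1 1 0 - p.2.1 0 0 * l.2.1 1 0)].
Proof. by split=> //=; rewrite mxE. Qed.

Lemma rot1M g h t : rot1 (g * h)%g t = rot1 g t + rot1 h t.
Proof. by rewrite /rot1 /= !mxE; ring. Qed.

Lemma rot2M g h t : rot2 (g * h)%g t = rot2 g t + rot2 h t.
Proof. by rewrite /rot2 /= !mxE; ring. Qed.

(* The rotations have determinant 1, hence preserve the symplectic form. *)
Lemma heis_mul_rot g h t : (g * h)%g.2 =
  g.2 + h.2 + 2^-1 * (rot1 g t * rot2 h t - rot1 h t * rot2 g t).
Proof.
rewrite /= /rot1 /rot2; congr (_ + _ * _).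
by rewrite -[LHS]mulr1 -(cos2Dsin2 t); ring.
Qed.

(** Over a fixed t, [h] acts by right multiplication by the inverse of its rotated copy (R(t)v',
    z'), and rotating is a group automorphism by [heis_mul_rot]. *)
Lemma heis_act_is_action : is_left_action (@heis_act R).
Proof.
split=> [p|g h p].
  by apply: Rheis_eq; rewrite !heis_actE /rot1 /rot2 //= !mxE; ring.
apply: Rheis_eq; rewrite !heis_actE // ?rot1M ?rot2M.
- by ring.
- by ring.
- by rewrite (heis_mul_rot _ _ p.1); ring.
Qed.

(** For a fixed rotation this is associativity: [l] multiplies on the left and the rotated inverse
    of [h] on the right. The shift of t by a multiple of 2 pi leaves the rotation unchanged. *)
Lemma heis_act_Lambda k l h p : Lambda k l ->
  heis_act h (l * p)%g = (l * heis_act h p)%g.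
Proof.
move=> [[m lm] _].
have cosP n x : cos (x + pi *+ 2 *+ n) = cos x :> R.
  by elim: n => [|n IH]; rewrite ?mulr0n ?addr0 // mulrSr addrA cosD2pi.
have sinP n x : sin (x + pi *+ 2 *+ n) = sin x :> R.
  by elim: n => [|n IH]; rewrite ?mulr0n ?addr0 // mulrSr addrA sinD2pi.
have sc (x : R) : sin (l.1 + x) = sin x /\ cos (l.1 + x) = cos x.
  rewrite lm [2 * _]mulrC mulr_natr [_ + x]addrC; case: m {lm} => n.
    by rewrite mulr_natr sinP cosP.
  (* For a negative multiple, the shift is subtracted and added back on the right-hand sides, which
     reduces to the positive case. *)
  rewrite NegzE mulrNz mulrN mulr_natr.
  by rewrite -{2 4}[x](addrNK (pi *+ 2 *+ n.+1)) sinP cosP.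
have [m1 mx my mz] := Rheis_mulE l p.
have [n1 nx ny nz] := Rheis_mulE l (heis_act h p).
have [sE cE] := sc p.1.
by apply: Rheis_eq; rewrite ?n1 ?nx ?ny ?nz !heis_actE ?m1 ?mx ?my ?mz;
  rewrite /rot1 /rot2 ?sE ?cE; ring.
Qed.

End HeisAct.

(** * Smoothness of the action followed by a left translation *)

Section SmoothAct.
Context {R : realType} {V : normedModType R}.
Implicit Types (l : Rheis R) (G : V -> heis R) (P : V -> Rheis R).

Lemma smooth_entry m n (f : V -> 'M[R]_(m, n)) i j :
  smooth_on setT f -> smooth_on setT (fun x => f x i j).
Proof.
move=> sf k; have {sf} := sf k; elim: k f => [|k IH] f.
  move=> cf x _.
  apply: (@continuous_comp _ _ _ f (fun M : 'M[R]_(m, n) => M i j)).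
    exact: cf.
  exact: coord_continuous.
move=> [df Df]; split=> [x _|v].
  exact: (differentiable_comp (df x I) (differentiable_coord _ i j)).
rewrite (_ : (fun x => _) = (fun x => 'D_v f x i j)); first exact: IH (Df v).
apply/funext => x; rewrite derive_mx ?mxE //.
exact/diff_derivable/df.
Qed.

Lemma smoothD {W : normedModType R} (f g : V -> W) :
  smooth_on setT f -> smooth_on setT g -> smooth_on setT (fun x => f x + g x).
Proof. by move=> sf sg k; apply: CkD. Qed.

Lemma smoothM (f g : V -> R) :
  smooth_on setT f -> smooth_on setT g -> smooth_on setT (fun x => f x * g x).
Proof. by move=> sf sg k; apply: CkM. Qed.

Lemma smooth_cst {W : normedModType R} (c : W) :
  smooth_on setT (fun _ : V => c).
Proof. by move=> k; exact: Ck_cst. Qed.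

Lemma smoothN (f : V -> R) :
  smooth_on setT f -> smooth_on setT (fun x => - f x).
Proof.
move=> sf; under eq_fun do rewrite -mulN1r.
by apply: smoothM => //; exact: smooth_cst.
Qed.

Lemma smooth_sin (f : V -> R) :
  smooth_on setT f -> smooth_on setT (fun x => sin (f x)).
Proof. by move=> sf k; have [] := Ck_sin_cos (sf k). Qed.

Lemma smooth_cos (f : V -> R) :
  smooth_on setT f -> smooth_on setT (fun x => cos (f x)).
Proof. by move=> sf k; have [] := Ck_sin_cos (sf k). Qed.

Lemma smooth_continuous {W : normedModType R} (f : V -> W) :
  smooth_on setT f -> continuous f.
Proof. by move=> sf x; exact: (sf 0%N x I). Qed.

Lemma eq_smooth {W : normedModType R} (f g : V -> W) :
  f =1 g -> smooth_on setT f -> smooth_on setT g.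
Proof. by move=> /funext ->. Qed.

(** Group element and point both vary with the parameter: a constant [G] gives the maps of a fixed
    [h], a varying one the joint smoothness of the action. *)
Lemma smooth_heis_act l G P :
  smooth_on setT (chart_map (heis_chart R) \o G) ->
  smooth_on setT (@Rheis_coords R \o P) ->
  smooth_on setT (fun w => Rheis_coords (l * heis_act (G w) (P w))%g).
Proof.
move=> sG sP.
have sG0 : smooth_on setT (fun w => (G w).1 0 0).
  by apply: eq_smooth (smooth_entry 0 0 sG) => w; rewrite mxE.
have sG1 : smooth_on setT (fun w => (G w).1 1 0).
  by apply: eq_smooth (smooth_entry 0 1 sG) => w; rewrite mxE.
have sG2 : smooth_on setT (fun w => (G w).2).
  by apply: eq_smooth (smooth_entry 0 2 sG) => w; rewrite mxE.
have sP0 : smooth_on setT (fun w => (P w).1).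
  by apply: eq_smooth (smooth_entry 0 0 sP) => w; rewrite mxE.
have sP1 : smooth_on setT (fun w => (P w).2.1 0 0).
  by apply: eq_smooth (smooth_entry 0 1 sP) => w; rewrite mxE.
have sP2 : smooth_on setT (fun w => (P w).2.1 1 0).
  by apply: eq_smooth (smooth_entry 0 2 sP) => w; rewrite mxE.
have sP3 : smooth_on setT (fun w => (P w).2.2).
  by apply: eq_smooth (smooth_entry 0 3 sP) => w; rewrite mxE.
have sA : smooth_on setT (fun w => rot1 (G w) (P w).1).
  apply: smoothD; last apply: smoothN; apply: smoothM => //.
    exact: smooth_cos.
  exact: smooth_sin.
have sB : smooth_on setT (fun w => rot2 (G w) (P w).1).
  apply: smoothD; apply: smoothM => //.
    exact: smooth_sin.
  exact: smooth_cos.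
have sX : smooth_on setT (fun w => (heis_act (G w) (P w)).2.1 0 0).
  under eq_fun do rewrite heis_actE.
  by apply: smoothD => //; apply: smoothN.
have sY : smooth_on setT (fun w => (heis_act (G w) (P w)).2.1 1 0).
  under eq_fun do rewrite heis_actE.
  by apply: smoothD => //; apply: smoothN.
have sZ : smooth_on setT (fun w => (heis_act (G w) (P w)).2.2).
  under eq_fun do rewrite heis_actE.
  apply: smoothD; first by apply: smoothD => //; apply: smoothN.
  apply: smoothN; apply: smoothM; first exact: smooth_cst.
  by apply: smoothD; last apply: smoothN; apply: smoothM.
have sT : smooth_on setT (fun w => (heis_act (G w) (P w)).1).
  by apply: eq_smooth sP0 => w; rewrite heis_actE.
apply: smooth_mx => i; rewrite ord1; elim/ord4_ind.
- apply: (@eq_smooth _ (fun w => l.1 + (heis_act (G w) (P w)).1)).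
    by move=> w; rewrite mxE.
  by apply: smoothD => //; exact: smooth_cst.
- apply: (@eq_smooth _ (fun w => l.2.1 0 0 + (heis_act (G w) (P w)).2.1 0 0)).
    by move=> w; rewrite [RHS]mxE /= mxE.
  by apply: smoothD => //; exact: smooth_cst.
- apply: (@eq_smooth _ (fun w => l.2.1 1 0 + (heis_act (G w) (P w)).2.1 1 0)).
    by move=> w; rewrite [RHS]mxE /= mxE.
  by apply: smoothD => //; exact: smooth_cst.
- apply: (@eq_smooth _ (fun w => l.2.2 + (heis_act (G w) (P w)).2.2
    + 2^-1 * (l.2.1 0 0 * (heis_act (G w) (P w)).2.1 1 0
              - (heis_act (G w) (P w)).2.1 0 0 * l.2.1 1 0))).
    by move=> w; rewrite [RHS]mxE.
  apply: smoothD; first by apply: smoothD => //; exact: smooth_cst.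
  apply: smoothM; first exact: smooth_cst.
  apply: smoothD; last apply: smoothN; apply: smoothM => //;
    exact: smooth_cst.
Qed.

End SmoothAct.

(** * The Jacobian of the action and the invariance of the metric *)

Section Jacobian.
Context {R : realType}.
Variables (l : Rheis R) (h : heis R).

Definition act_coords (u : 'rV[R]_4) : 'rV[R]_4 :=
  Rheis_coords (l * heis_act h (Rheis_point u))%g.

Lemma smooth_act_coords : smooth_on setT act_coords.
Proof.
apply: smooth_heis_act; first exact: smooth_cst.
rewrite (_ : _ \o _ = id); last by apply/funext => u /=; exact: Rheis_pointK.
by apply: smooth_mx => i j k; exact: Ck_coord.
Qed.

(** Row i holds the partial derivatives along the i-th coordinate, as Jacobians act on row vectors;
    the first row comes from A' = - B and B' = A. *)
Definition act_jacobian (u : 'rV[R]_4) : 'M[R]_4 :=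
  let A := rot1 h (u 0 0) in let B := rot2 h (u 0 0) in
  mx_of_rows 4 4
    [:: [:: 1; B; - A;
            - 2^-1 * ((u 0 1 + l.2.1 0 0) * A + (u 0 2 + l.2.1 1 0) * B)];
        [:: 0; 1; 0; - 2^-1 * (B + l.2.1 1 0)];
        [:: 0; 0; 1; 2^-1 * (A + l.2.1 0 0)];
        [:: 0; 0; 0; 1]].

Lemma jacobian_act_coords u : 'J act_coords u = act_jacobian u.
Proof.
have dE : differentiable act_coords u := (smooth_act_coords 1).1 u I.
(* It suffices to differentiate along an arbitrary [v]; the basis vectors then give the rows. *)
suff H (v : 'rV_4) : 'D_v act_coords u = v *m act_jacobian u.
  by apply/row_matrixP => i; rewrite !rowE -deriveEjacobian.
have pC i : is_derive u v (fun w : 'rV[R]_4 => w 0 i) (v 0 i).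
  apply: DeriveDef; first exact/diff_derivable/differentiable_coord.
  have := derive_mx (@derivable_id R 'rV[R]_4 u v).
  by rewrite derive_id => /matrixP/(_ 0 i); rewrite mxE.
have pcos : is_derive u v (fun w : 'rV[R]_4 => cos (w 0 0))
    (- sin (u 0 0) * v 0 0).
  have [d1 d2] := @derive_post R 'rV[R]_4 _ cos _ u v
    (differentiable_coord u 0 0) (is_derive_cos _).
  apply: DeriveDef; first exact/diff_derivable/d1.
  by rewrite d2; case: (pC 0) => _ ->.
have psin : is_derive u v (fun w : 'rV[R]_4 => sin (w 0 0))
    (cos (u 0 0) * v 0 0).
  have [d1 d2] := @derive_post R 'rV[R]_4 _ sin _ u v
    (differentiable_coord u 0 0) (is_derive_sin _).
  apply: DeriveDef; first exact/diff_derivable/d1.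
  by rewrite d2; case: (pC 0) => _ ->.
have k (c : R) : is_derive u v (fun _ : 'rV[R]_4 => c) 0.
  exact: is_derive_cst.
have pA : is_derive u v (fun w : 'rV[R]_4 => rot1 h (w 0 0))
    (- rot2 h (u 0 0) * v 0 0).
  apply: is_derive_eq (is_derive_addf (is_derive_mulf pcos (k (h.1 0 0)))
    (is_derive_oppf (is_derive_mulf psin (k (h.1 1 0))))) _.
  by rewrite /rot2; ring.
have pB : is_derive u v (fun w : 'rV[R]_4 => rot2 h (w 0 0))
    (rot1 h (u 0 0) * v 0 0).
  apply: is_derive_eq (is_derive_addf (is_derive_mulf psin (k (h.1 0 0)))
    (is_derive_mulf pcos (k (h.1 1 0)))) _.
  by rewrite /rot1; ring.
have pX := is_derive_addf (pC 1) (is_derive_oppf pA).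
have pY := is_derive_addf (pC 2) (is_derive_oppf pB).
have pZ := is_derive_addf (is_derive_addf (pC 3) (k (- h.2)))
  (is_derive_oppf (is_derive_mulf (k 2^-1)
    (is_derive_addf (is_derive_mulf (pC 1) pB)
                    (is_derive_oppf (is_derive_mulf (pC 2) pA))))).
have pZl := is_derive_addf (is_derive_addf (k l.2.2) pZ)
  (is_derive_mulf (k 2^-1)
    (is_derive_addf (is_derive_mulf (k (l.2.1 0 0)) pY)
                    (is_derive_oppf (is_derive_mulf pX (k (l.2.1 1 0)))))).
rewrite derive_mx; last exact: diff_derivable.
have eqD (f g : 'rV[R]_4 -> R) d d' :
    is_derive u v f d -> f =1 g -> d = d' -> 'D_v g u = d'.
  by move=> [_ <-] /funext <- ->.
apply/rowP => j; rewrite [RHS]mxE [LHS]mxE sum_ord4; elim/ord4_ind: j.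
- apply: (eqD _ _ _ _ (is_derive_addf (k l.1) (pC 0))) => [w|].
    by rewrite !mxE /= heis_actE.
  by rewrite !mxE /=; ring.
- apply: (eqD _ _ _ _ (is_derive_addf (k (l.2.1 0 0)) pX)) => [w|].
    by rewrite [RHS]mxE /= mxE heis_actE /= mxE.
  by rewrite !mxE /=; ring.
- apply: (eqD _ _ _ _ (is_derive_addf (k (l.2.1 1 0)) pY)) => [w|].
    by rewrite [RHS]mxE /= mxE heis_actE /= mxE.
  by rewrite !mxE /=; ring.
- apply: (eqD _ _ _ _ pZl) => [w|].
    by rewrite [RHS]mxE /= !heis_actE /= !mxE.
  by rewrite !mxE /=; ring.
Qed.

(* Since R' = - J R, this is a polynomial identity in rot1 h t and rot2 h t. *)
Lemma gram_act u : gram (Rheis_point u) =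
  'J act_coords u *m gram (Rheis_point (act_coords u)) *m ('J act_coords u)^T.
Proof.
rewrite jacobian_act_coords /act_coords Rheis_coordsK.
have [_ + + _] := Rheis_mulE l (heis_act h (Rheis_point u)).
(* [gram] reads only the x and y coordinates of a point, so these two are all that is kept of the
   image. *)
move: (l * _)%g => q qx qy.
apply/matrixP => i j; rewrite [RHS]mxE sum_ord4 ![(_ *m _) i _]mxE !sum_ord4.
rewrite ![_^T _ _]mxE.
by elim/ord4_ind: i; elim/ord4_ind: j;
  rewrite !mxE /= qx qy !heis_actE /= !mxE /=; field.
Qed.

Lemma gram_lorentz (p : Rheis R) : lorentz_form (gram p).
Proof.
pose x := p.2.1 0 0; pose y := p.2.1 1 0.
(* The rows are T - Z/2, X, Y, T + Z/2 in the left-invariant frame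
   T = d/dt, X = d/dx - (y/2) d/dz, Y = d/dy + (x/2) d/dz, Z = d/dz. *)
pose P : 'M[R]_4 := mx_of_rows 4 4
  [:: [:: 1; 0; 0; - 2^-1]; [:: 0; 1; 0; - 2^-1 * y];
      [:: 0; 0; 1; 2^-1 * x]; [:: 1; 0; 0; 2^-1]].
pose D : 'M[R]_4 := diag_mx (\row_i (if i == 0%N :> nat then -1 else 1)).
have PGP : P *m gram p *m P^T = D.
  apply/matrixP => i j; rewrite !mxE sum_ord4 ![(_ *m _) i _]mxE !sum_ord4.
  rewrite ![_^T _ _]mxE.
  by elim/ord4_ind: i; elim/ord4_ind: j; rewrite !mxE /= -/x -/y; field.
exists P => //.
have DD : D *m D = 1%:M.
  apply/matrixP => i j; rewrite !mxE sum_ord4.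
  by elim/ord4_ind: i; elim/ord4_ind: j; rewrite !mxE /=; ring.
(* Since [D] is its own inverse, [PGP] exhibits a right inverse of the square matrix [P]. *)
have [] // := @mulmx1_unit _ _ P (gram p *m P^T *m D).
by rewrite !mulmxA PGP.
Qed.

End Jacobian.

(** * Continuity and the projection *)

(** A neighbourhood of a matrix contains a product of neighbourhoods of its entries, and finitely
    many conditions can be met simultaneously. *)
Lemma continuous_mx (T U : topologicalType) m n (f : T -> 'M[U]_(m, n)) :
  (forall i j, continuous (fun x => f x i j)) -> continuous f.
Proof.
move=> fc x A [P Px sPA]; rewrite /nbhs /=.
apply: (filterS (P := [set y | forall i j, P i j (f y i j)])).
  by move=> y Py; apply: sPA.
apply: filter_forall => i; apply: filter_forall => j.
exact: fc (Px i j).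
Qed.

Section ProductContinuity.
Context {T U V : topologicalType}.

Lemma continuous_pair (f : T -> U) (g : T -> V) :
  continuous f -> continuous g -> continuous (fun x => (f x, g x)).
Proof. by move=> cf cg x; apply: cvg_pair; [exact: cf|exact: cg]. Qed.

Lemma continuous_fst (f : T -> U * V) :
  continuous f -> continuous (fun x => (f x).1).
Proof.
move=> cf x; apply: (@continuous_comp _ _ _ f fst); first exact: cf.
exact: cvg_fst.
Qed.

Lemma continuous_snd (f : T -> U * V) :
  continuous f -> continuous (fun x => (f x).2).
Proof.
move=> cf x; apply: (@continuous_comp _ _ _ f snd); first exact: cf.
exact: cvg_snd.
Qed.

End ProductContinuity.

Section Continuity.
Context {R : realType}.

Lemma continuous_entry (T : topologicalType) m n (f : T -> 'M[R]_(m, n)) i j :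
  continuous f -> continuous (fun x => f x i j).
Proof.
move=> cf x; apply: (@continuous_comp _ _ _ f (fun M : 'M[R]_(m, n) => M i j)).
  exact: cf.
exact: coord_continuous.
Qed.

Lemma heis_entries_continuous (T : topologicalType) (f : T -> heis R) :
  continuous f -> [/\ continuous (fun x => (f x).1 0 0),
    continuous (fun x => (f x).1 1 0) & continuous (fun x => (f x).2)].
Proof.
move=> cf; have c1 := continuous_fst cf.
by split; try exact: continuous_entry; exact: continuous_snd.
Qed.

Lemma Rheis_coords_continuous : continuous (@Rheis_coords R).
Proof.
have cid : continuous (@id (Rheis R)) by move=> x; exact: cvg_id.
have [c1 c2 c3] := heis_entries_continuous (continuous_snd cid).
apply: continuous_mx => i; rewrite ord1; elim/ord4_ind.
- by under eq_fun do rewrite mxE /=; apply: continuous_fst.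
- by under eq_fun do rewrite mxE.
- by under eq_fun do rewrite mxE.
- by under eq_fun do rewrite mxE.
Qed.

Lemma Rheis_point_continuous : continuous (@Rheis_point R).
Proof.
have cc i : continuous (fun u : 'rV[R]_4 => u 0 i) by exact: coord_continuous.
apply: (continuous_pair (cc 0)); apply: continuous_pair; last exact: cc.
apply: continuous_mx => i j; rewrite ord1; elim/ord2_ind: i.
  by under eq_fun do rewrite mxE; exact: cc.
by under eq_fun do rewrite mxE; exact: cc.
Qed.

Lemma heis_map_continuous : continuous (chart_map (heis_chart R)).
Proof.
have cid : continuous (@id (heis R)) by move=> x; exact: cvg_id.
have [c1 c2 c3] := heis_entries_continuous cid.
by apply: continuous_mx => i [[|[|[|//]]] ltj];
  under eq_fun do rewrite mxE /=.
Qed.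

Lemma heis_mapK : cancel (chart_map (heis_chart R)) (chart_inv (heis_chart R)).
Proof. by move=> h; apply: heis_eq; rewrite /= !mxE. Qed.

Lemma heis_invK : cancel (chart_inv (heis_chart R)) (chart_map (heis_chart R)).
Proof.
move=> u; apply/rowP => -[[|[|[|//]]] lti]; rewrite /= !mxE /= ?mxE /=;
  by congr (u _ _); apply/val_inj.
Qed.

(** The joint action read in a product chart: three coordinates for the group element, then four for
    the point. *)
Definition prod_act (l : Rheis R) (w : 'rV[R]_(3 + 4)) : Rheis R :=
  (l * heis_act (chart_inv (heis_chart R) (lsubmx w))
                (Rheis_point (rsubmx w)))%g.

Lemma smooth_prod_act l : smooth_on setT (@Rheis_coords R \o prod_act l).
Proof.
have sl (n m : nat) (f : 'rV[R]_(3 + 4) -> 'M[R]_(n, m))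
    (g : 'I_n -> 'I_m -> 'I_(3 + 4)) :
    (forall w i j, f w i j = w 0 (g i j)) -> smooth_on setT f.
  move=> fE; apply: smooth_mx => i j d; under eq_fun do rewrite fE.
  exact: Ck_coord.
apply: smooth_heis_act.
  apply: (sl _ _ _ (fun _ j => lshift 4 j)) => w i j.
  rewrite (_ : (_ \o _) w = lsubmx w); last exact: heis_invK.
  by rewrite mxE ord1.
apply: (sl _ _ _ (fun _ j => rshift 3 j)) => w i j.
rewrite (_ : (_ \o _) w = rsubmx w); last exact: Rheis_pointK.
by rewrite mxE ord1.
Qed.

(** In global coordinates the action is [prod_act 1%g], whose smoothness is known; only the
    coordinate maps remain to be shown continuous. *)
Lemma heis_act_continuous :
  continuous (fun hp : heis R * Rheis R => heis_act hp.1 hp.2).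
Proof.
have -> : (fun hp : heis R * Rheis R => heis_act hp.1 hp.2) =
    @Rheis_point R \o (@Rheis_coords R \o prod_act 1%g) \o
    (fun hp : heis R * Rheis R =>
       row_mx (chart_map (heis_chart R) hp.1) (Rheis_coords hp.2)).
  apply/funext => hp /=; rewrite /prod_act row_mxKl row_mxKr.
  by rewrite !Rheis_coordsK heis_mapK mul1g.
move=> hp; apply: continuous_comp; last first.
  apply: continuous_comp; last exact: Rheis_point_continuous.
  exact: (smooth_continuous (smooth_prod_act _)).
have cid : continuous (@id (heis R * Rheis R)) by move=> x; exact: cvg_id.
have c1 : continuous
    (fun hp : heis R * Rheis R => chart_map (heis_chart R) hp.1).
  move=> x; apply: continuous_comp; first exact: continuous_fst.
  exact: heis_map_continuous.
have c2 : continuous (fun hp : heis R * Rheis R => Rheis_coords hp.2).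
  move=> x; apply: continuous_comp; first exact: continuous_snd.
  exact: Rheis_coords_continuous.
apply: continuous_mx => i j.
under eq_fun do rewrite mxE; case: splitP => k _; exact: continuous_entry.
Qed.

(** Left translation by [l] is the case of the neutral group element in [act_coords]. *)
Lemma Rheis_mul_continuous l : continuous (fun p : Rheis R => (l * p)%g).
Proof.
have -> : (fun p => (l * p)%g) =
    @Rheis_point R \o act_coords l 1%g \o @Rheis_coords R.
  apply/funext => p; rewrite /= /act_coords !Rheis_coordsK.
  by rewrite (@heis_act_is_action R).1.
move=> p; apply: continuous_comp; first exact: Rheis_coords_continuous.
apply: continuous_comp; last exact: Rheis_point_continuous.
exact: (smooth_continuous (smooth_act_coords _ _)).
Qed.

End Continuity.

(** * The projection onto the quotient *)

Section Projection.
Context {R : realType} {k : nat} (hk : (0 < k)%N).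
Local Notation proj := (nil_proj R hk).

Lemma nil_projP p q : proj p = proj q <-> exists2 l, Lambda k l & q = (l * p)%g.
Proof.
split=> [/eqmodP/asboolP //|H]; apply/eqmodP; exact/asboolP.
Qed.

Lemma nil_proj_Lambda l p : Lambda k l -> proj (l * p)%g = proj p.
Proof. by move=> Ll; apply/esym/nil_projP; exists l. Qed.

Lemma nil_proj_surj q : exists p, proj p = q.
Proof. by exists (repr q); exact: reprK. Qed.

Lemma nil_proj_continuous : continuous proj.
Proof. exact: pi_continuous. Qed.

(** The saturation of [A] is a union of its lattice translates, written as preimages of [A] under
    continuous left translations. *)
Lemma nil_proj_open (A : set (Rheis R)) : open A -> open (proj @` A).
Proof.
move=> oA; rewrite /open /= /quotient_open.
rewrite (_ : _ @^-1` _ =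
    \bigcup_(l in Lambda k) ((fun p => (l * p)%g) @^-1` A)).
  apply: bigcup_open => l _; apply: open_comp => // p _.
  exact: Rheis_mul_continuous.
apply/seteqP; split=> [q [p Ap /esym/nil_projP[l Ll pE]]|q [l Ll Aq]].
  by exists l => //=; rewrite -pE.
by exists (l * q)%g => //; exact: nil_proj_Lambda.
Qed.

Lemma nil_proj_nbhs p (A : set (Rheis R)) :
  nbhs p A -> nbhs (proj p) (proj @` A).
Proof.
rewrite !nbhsE => -[B [oB Bp] BA]; exists (proj @` B); last exact: image_subset.
by split; [exact: nil_proj_open|exists p].
Qed.

End Projection.

(** * The induced action *)

Section Nilmanifold.
Context {R : realType} {k : nat} (hk : (0 < k)%N).
Local Notation proj := (nil_proj R hk).
Local Notation atlas := (nil_atlas R hk).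
Implicit Types (b : chart R (nilmanifold R hk) 4).

Lemma nil_chart_inv b u : atlas b -> chart_inv b u = proj (Rheis_point u).
Proof. by case=> _ ->. Qed.

Lemma nil_chartK b q : atlas b -> chart_dom b q ->
  proj (Rheis_point (chart_map b q)) = q.
Proof.
move=> Ab bq; rewrite -(nil_chart_inv _ Ab).
by case: Ab => -[_ _ + _ _] _; apply.
Qed.

(* A chart differs from any continuous lift by a deck transformation which is
   locally constant because the image of the chart is open. *)
Lemma nil_chart_lift b : atlas b ->
  forall (T : topologicalType) (G : T -> Rheis R) x,
  continuous G -> chart_dom b (proj (G x)) ->
  exists2 l, Lambda k l &
    \forall y \near x, chart_map b (proj (G y)) = Rheis_coords (l * G y)%g.
Proof.
move=> Ab T G x cG bx.
have /esym/nil_projP[l Ll lG] := nil_chartK Ab bx.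
exists l => //.
have cH : continuous (fun y => Rheis_coords (l * G y)%g).
  move=> y.
  apply: (@continuous_comp _ _ _ (fun y => (l * G y)%g) (@Rheis_coords R)).
    apply: (@continuous_comp _ _ _ G (fun p => (l * p)%g)); first exact: cG.
    exact: Rheis_mul_continuous.
  exact: Rheis_coords_continuous.
have imgx : chart_img b (Rheis_coords (l * G x)%g).
  by exists (proj (G x)) => //; rewrite -lG Rheis_pointK.
have img_nbhs : nbhs (Rheis_coords (l * G x)%g) (chart_img b).
  by apply: open_nbhs_nbhs; split=> //; case: Ab => -[].
have near_img : \forall y \near x, chart_img b (Rheis_coords (l * G y)%g).
  exact: (cH x _ img_nbhs).
apply: filterS near_img => y [q bq qE].
(* The chart inverse is the projection, so the [q] with these coordinates can only be
   [proj (G y)]. *)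
by rewrite -qE -(nil_chartK Ab bq) qE Rheis_coordsK nil_proj_Lambda.
Qed.

(** By [nil_chart_lift] the expression is, near each point, the lift [G] translated by some [l]. As
    [l] depends on the point, smoothness is assumed for every translate. *)
Lemma smooth_on_nil_chart b (V : normedModType R) (U : set V)
    (G : V -> Rheis R) :
  atlas b ->
  (forall l, smooth_on setT (fun w => Rheis_coords (l * G w)%g)) ->
  (forall x, U x -> chart_dom b (proj (G x))) ->
  smooth_on U (fun x => chart_map b (proj (G x))).
Proof.
move=> Ab sG bU; apply: smooth_on_local => x Ux.
have cG : continuous G.
  rewrite (_ : G = @Rheis_point R \o (fun w => Rheis_coords (1 * G w)%g)).
    move=> y; apply: continuous_comp; last exact: Rheis_point_continuous.
    exact: smooth_continuous.
  by apply/funext => w /=; rewrite Rheis_coordsK mul1g.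
have [l Ll lE] := nil_chart_lift Ab cG (bU _ Ux).
by exists (fun w => Rheis_coords (l * G w)%g).
Qed.

Lemma heis_act_proj h p q :
  proj p = proj q -> proj (heis_act h p) = proj (heis_act h q).
Proof.
by move=> /nil_projP[l Ll ->]; rewrite (heis_act_Lambda _ _ Ll) nil_proj_Lambda.
Qed.

Definition nil_act (h : heis R) (q : nilmanifold R hk) : nilmanifold R hk :=
  proj (heis_act h (repr q)).

Lemma nil_actE h p : nil_act h (proj p) = proj (heis_act h p).
Proof. by apply: heis_act_proj; exact: reprK. Qed.

Lemma nil_act_is_action : is_left_action nil_act.
Proof.
have [a1 aM] := @heis_act_is_action R.
split=> [q|g h q]; have [p <-] := nil_proj_surj q; first by rewrite nil_actE a1.
by rewrite !nil_actE aM.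
Qed.

(** A product neighbourhood found upstairs is pushed down in its second factor, which stays a
    neighbourhood because the projection is open. *)
Lemma nil_act_continuous :
  continuous (fun hq : heis R * nilmanifold R hk => nil_act hq.1 hq.2).
Proof.
move=> [h q] W /=; have [p <-] := nil_proj_surj q; rewrite nil_actE => nW.
have c : {for (h, p), continuous
    (fun hp : heis R * Rheis R => proj (heis_act hp.1 hp.2))}.
  apply: (@continuous_comp _ _ _
    (fun hp : heis R * Rheis R => heis_act hp.1 hp.2)).
    exact: heis_act_continuous.
  exact: nil_proj_continuous.
have [[A B] /= [nA nB] ABW] := c _ nW.
exists (A, proj @` B); first by split=> //=; exact: nil_proj_nbhs.
by move=> [g _] /= [Ag [p' Bp' <-]] /=; rewrite nil_actE; exact: (ABW (g, p')).
Qed.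

Lemma nil_act1_continuous h : continuous (nil_act h).
Proof.
have cpair : continuous (fun q : nilmanifold R hk => (h, q)).
  apply: continuous_pair; first exact: cst_continuous.
  by move=> q; exact: cvg_id.
move=> q; apply: (@continuous_comp _ _ _ (fun q => (h, q))
  (fun hq : heis R * nilmanifold R hk => nil_act hq.1 hq.2));
  first exact: cpair.
exact: nil_act_continuous.
Qed.

Lemma local_dom_nil (X : topologicalType) m (a : chart R X m) b
    (F : X -> nilmanifold R hk) u :
  (forall x, chart_dom a x -> chart_inv a (chart_map a x) = x) ->
  local_dom a b F u -> chart_dom b (F (chart_inv a u)).
Proof. by move=> aK [x [ax bFx] <-]; rewrite aK. Qed.

Lemma smooth_map_nil_act h : smooth_map atlas atlas (nil_act h).
Proof.
split=> [|a b Aa Ab]; first exact: nil_act1_continuous.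
have aK : forall x, chart_dom a x -> chart_inv a (chart_map a x) = x.
  by case: Aa => -[].
rewrite /local_expr (_ : _ \o _ =
    fun u => chart_map b (proj (heis_act h (Rheis_point u)))).
  apply: smooth_on_nil_chart => // [l|u /(local_dom_nil aK)].
    exact: smooth_act_coords.
  by rewrite nil_chart_inv // nil_actE.
by apply/funext => u /=; rewrite nil_chart_inv // nil_actE.
Qed.

Lemma smooth_map_prod_nil_act :
  smooth_map (prod_atlas (heis_atlas R) atlas) atlas
    (fun hq => nil_act hq.1 hq.2).
Proof.
split=> [|_ b [_ -> [a Aa <-]] Ab]; first exact: nil_act_continuous.
pose c := prod_chart (heis_chart R) a.
have aK x : chart_dom c x -> chart_inv c (chart_map c x) = x.
  case: x => g q [_ aq] /=; rewrite row_mxKl row_mxKr.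
  (* The explicit formula is folded back into the inverse of the Heisenberg chart, so that
     [heis_mapK] applies. *)
  rewrite -[X in (X, _)]/(chart_inv (heis_chart R)
    (chart_map (heis_chart R) g)) heis_mapK.
  by rewrite nil_chart_inv // nil_chartK.
rewrite /local_expr (_ : _ \o _ = fun w => chart_map b (proj (prod_act 1%g w))).
  apply: smooth_on_nil_chart => // [l|u /(local_dom_nil aK)].
    apply: eq_smooth (smooth_prod_act l) => w.
    by rewrite /= /prod_act mul1g.
  by rewrite /= nil_chart_inv // nil_actE /prod_act mul1g.
by apply/funext => u /=; rewrite nil_chart_inv // nil_actE /prod_act mul1g.
Qed.

(** The source is left general in order to serve both the induced maps and, with [h] neutral and [X]
    the group N, the projection. Near the point the local expression is [act_coords l h], to which
    [gram_act] applies. *)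
Lemma nil_preserves_metric (X : topologicalType) (a : chart R X 4) b
    (F : X -> nilmanifold R hk) h x :
  atlas b ->
  (forall u, F (chart_inv a u) = proj (heis_act h (Rheis_point u))) ->
  chart_inv a (chart_map a x) = x -> chart_dom b (F x) ->
  let D := 'J (local_expr a b F) (chart_map a x) in
  gram (Rheis_point (chart_map a x)) = D *m nil_metric R hk b (F x) *m D^T.
Proof.
move=> Ab FE ax bFx; set u := chart_map a x.
have aK : chart_inv a u = x := ax.
have bu : chart_dom b (proj (heis_act h (Rheis_point u))) by rewrite -FE aK.
have cG : continuous (fun u => heis_act h (Rheis_point u)).
  rewrite (_ : (fun u => _) = @Rheis_point R \o (act_coords 1%g h)).
    move=> y; apply: continuous_comp; last exact: Rheis_point_continuous.
    exact: (smooth_continuous (smooth_act_coords _ _)).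
  by apply/funext => w /=; rewrite /act_coords Rheis_coordsK mul1g.
have [l Ll lE] := nil_chart_lift Ab cG bu.
have fE : \near u, act_coords l h u = local_expr a b F u.
  by apply: filterS lE => w wE; rewrite /local_expr /= FE wE.
have JE := near_eq_jacobian fE ((smooth_act_coords l h 1).1 u I).
move=> D; rewrite /D JE (gram_act l h) /nil_metric.
congr (_ *m gram (Rheis_point _) *m _).
by rewrite (nbhs_singleton fE) /local_expr /= aK.
Qed.

Lemma is_isometry_nil_act h :
  is_isometry atlas (nil_metric R hk) atlas (nil_metric R hk) (nil_act h).
Proof.
have [a1 aM] := nil_act_is_action.
split.
  exists (nil_act h^-1%g); split; try exact: smooth_map_nil_act.
    by move=> q; rewrite -aM mulVg a1.
  by move=> q; rewrite -aM mulgV a1.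
move=> a b x Aa Ab ax bx; apply: nil_preserves_metric => //.
  by move=> u; rewrite nil_chart_inv // nil_actE.
by rewrite nil_chart_inv // nil_chartK.
Qed.

Lemma nil_act1 : nil_act 1%g = id.
Proof. by apply/funext; exact: nil_act_is_action.1. Qed.

(** The transformation rule under changes of charts is the invariance of the metric under the
    identity, which is [nil_act] at the neutral element. *)
Lemma nil_lorentz_metric : lorentz_metric atlas (nil_metric R hk).
Proof.
split=> [a Aa|a x _ _|]; first last.
- by rewrite -nil_act1; exact: (is_isometry_nil_act _).2.
- exact: gram_lorentz.
apply: smooth_on_local => u [q aq <-].
(* On the image of any chart the metric has this one expression, whose entries are constants or
   multiples of a coordinate. *)
exists (fun u => gram (Rheis_point u)).
  apply: smooth_mx => i j.
  have sc c i' : smooth_on setT (fun w : 'rV[R]_4 => c * w 0 i').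
    by apply: smoothM; [exact: smooth_cst|move=> d; exact: Ck_coord].
  by elim/ord4_ind: i; elim/ord4_ind: j;
    under eq_fun do rewrite mxE /= ?mxE /=; (exact: smooth_cst || exact: sc).
have : nbhs (chart_map a q) (chart_img a).
  apply: open_nbhs_nbhs; split; first by case: Aa => -[].
  by exists q.
apply: filterS => _ [q' aq' <-].
by rewrite /nil_metric nil_chart_inv // nil_chartK.
Qed.

Lemma nil_proj_local_isometry :
  is_local_isometry (Rheis_atlas R) (Rheis_metric R)
    atlas (nil_metric R hk) proj.
Proof.
have [a1 _] := @heis_act_is_action R.
split; last first.
  move=> _ b p -> Ab _ bp.
  rewrite /Rheis_metric -[X in gram X]Rheis_coordsK.
  apply: (@nil_preserves_metric _
    (Chart setT (@Rheis_coords R) (@Rheis_point R)) b _ 1%g) => //.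
    by move=> u; rewrite a1.
  exact: Rheis_coordsK.
split=> [|_ b -> Ab]; first exact: nil_proj_continuous.
apply: smooth_on_nil_chart => // [l|u].
  apply: eq_smooth (smooth_act_coords l 1%g) => w.
  by rewrite /act_coords a1.
by apply: local_dom_nil => x _ /=; exact: Rheis_coordsK.
Qed.

Lemma smooth_map_heis_act :
  smooth_map (prod_atlas (heis_atlas R) (Rheis_atlas R)) (Rheis_atlas R)
    (fun hp => heis_act hp.1 hp.2).
Proof.
split=> [|_ b [_ -> [_ -> <-]] ->]; first exact: heis_act_continuous.
apply: smooth_on_local => w _; exists (@Rheis_coords R \o prod_act 1%g).
  exact: smooth_prod_act.
by apply: filterE => u; rewrite /local_expr /= /prod_act mul1g.
Qed.

End Nilmanifold.

(** * The compact nilmanifold *)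

Section Lattice.
Context {R : realType} {k : nat} (hk : (0 < k)%N).
Local Notation proj := (nil_proj R hk).
Local Notation atlas := (nil_atlas R hk).

Definition Lambda_point (m a b c : int) : Rheis R :=
  (2 * pi * m%:~R,
   (mx_of_rows 2 1 [:: [:: a%:~R]; [:: b%:~R]], c%:~R / (2 * k)%:R)).

Lemma Lambda_pointP m a b c : Lambda k (Lambda_point m a b c).
Proof. by split; [exists m|exists a, b, c; rewrite !mxE]. Qed.

Lemma floor_frac (x : R) : 0 <= x - (Num.floor x)%:~R < 1.
Proof.
by rewrite subr_ge0 floor_le_tmp ltrBlDl -intrD1 floorD1_gt.
Qed.

(** Every orbit meets the box [0, 2 pi] x [0, 1]^3, by taking fractional parts. *)
Lemma nil_compact : compact [set: nilmanifold R hk].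
Proof.
pose B : 'I_4 -> R := fun i => if i == 0 then 2 * pi else 1.
pose K := [set u : 'rV[R]_4 | forall i, `[0, B i]%classic (u ord0 i)].
have cK : compact K.
  apply: (@rV_compact R 4 (fun i => `[0, B i]%classic)) => i.
  exact: segment_compact.
have -> : [set: nilmanifold R hk] = (proj \o @Rheis_point R) @` K.
  apply/seteqP; split=> // q _; have [p <-] := nil_proj_surj q.
  pose a := - Num.floor (p.2.1 0 0); pose b := - Num.floor (p.2.1 1 0).
  pose m := - Num.floor (p.1 / (2 * pi)).
  (* Translating by [a] and [b] also changes z through the symplectic term; [w] is the resulting z,
     and [c] is chosen last to reduce it modulo 1/(2k). *)
  pose w : R := p.2.2 + 2^-1 * (a%:~R * p.2.1 1 0 - p.2.1 0 0 * b%:~R).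
  pose c := - Num.floor (w * (2 * k)%:R).
  have k0 : 0 < (2 * k)%:R :> R by rewrite ltr0n muln_gt0.
  exists (Rheis_coords (Lambda_point m a b c * p)%g); last first.
    by rewrite /= Rheis_coordsK nil_proj_Lambda //; exact: Lambda_pointP.
  have [lt lx ly lz] := Rheis_mulE (Lambda_point m a b c) p.
  have pi2 : 0 < 2 * pi :> R by rewrite mulr_gt0 ?pi_gt0.
  elim/ord4_ind; rewrite mxE /= ?lt ?lx ?ly ?lz /= in_itv /= ?mxE /=.
  - rewrite /m /B /= mulrNz.
    have /andP[f0 f1] := floor_frac (p.1 / (2 * pi)).
    have tE : p.1 = 2 * pi * (p.1 / (2 * pi)) by rewrite mulrC divfK ?gt_eqF.
    apply/andP; split; rewrite {2}tE; nra.
  - rewrite /a /B /= mulrNz addrC.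
    by have /andP[-> /ltW ->] := floor_frac (p.2.1 0 0).
  - rewrite /b /B /= mulrNz addrC.
    by have /andP[-> /ltW ->] := floor_frac (p.2.1 1 0).
  - have /andP[f0 f1] := floor_frac (w * (2 * k)%:R).
    have -> : c%:~R / (2 * k)%:R + p.2.2
      + 2^-1 * (a%:~R * p.2.1 1 0 - p.2.1 0 0 * b%:~R)
      = (w * (2 * k)%:R - (Num.floor (w * (2 * k)%:R))%:~R) / (2 * k)%:R.
      rewrite /c mulrNz; move: (Num.floor (w * _)) (lt0r_neq0 k0) => d.
      by rewrite /w; move: (2 * k)%:R => k2 k20; field.
    apply/andP; split; first by rewrite divr_ge0 // ltW.
    rewrite /B /= ler_pdivrMr // mul1r (le_trans (ltW f1)) //.
    by rewrite ler1n muln_gt0.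
apply: continuous_compact => //; apply: continuous_subspaceT => u.
apply: continuous_comp; first exact: Rheis_point_continuous.
exact: nil_proj_continuous.
Qed.

(** A non-integer lies strictly between its floor and the next integer, and that open interval
    contains no integer. *)
Lemma int_num_closed : closed [set x : R | x \is a Num.int].
Proof.
rewrite -openC openE => x /= /negP xN; rewrite /interior.
have xI : x \in `](Num.floor x)%:~R, (Num.floor x + 1)%:~R[.
  rewrite in_itv /= floorD1_gt andbT lt_neqAle floor_le_tmp andbT.
  by apply: contra xN => /eqP <-; exact: intr_int.
have := near_in_itvoo xI; apply: filterS => y.
rewrite /= in_itv /= => /andP[+ +] /intrP[n yE]; rewrite yE !ltr_int => flt.
by rewrite ltzD1 leNgt flt.
Qed.

Definition Lambda_graph : set (Rheis R * Rheis R) :=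
  [set pq | exists2 l, Lambda k l & pq.2 = (l * pq.1)%g].

(** Solving [pq.2 = l * pq.1] for [l] gives four continuous functions of the pair; membership in the
    lattice means that their rescaled values are integers. *)
Lemma Lambda_graph_closed : closed Lambda_graph.
Proof.
have cid : continuous (@id (Rheis R * Rheis R)) by move=> x; exact: cvg_id.
have c1 := continuous_fst cid; have c2 := continuous_snd cid.
have [x1 y1 z1] := heis_entries_continuous (continuous_snd c1).
have [x2 y2 z2] := heis_entries_continuous (continuous_snd c2).
have t1 := continuous_fst c1; have t2 := continuous_fst c2.
have k0 : (2 * k)%:R != 0 :> R by rewrite pnatr_eq0 muln_eq0 /= -lt0n.
have pi0 : 2 * pi != 0 :> R by rewrite mulf_neq0 ?gt_eqF ?pi_gt0.
have pre (f : Rheis R * Rheis R -> R) : continuous f ->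
    closed [set x | f x \is a Num.int].
  by move=> cf; apply: (closed_comp (fun x _ => cf x)) int_num_closed.
have cB (f g : Rheis R * Rheis R -> R) : continuous f -> continuous g ->
    continuous (fun x => f x - g x).
  by move=> cf cg x; apply: continuousB; [exact: cf|exact: cg].
have cM (f g : Rheis R * Rheis R -> R) : continuous f -> continuous g ->
    continuous (fun x => f x * g x).
  by move=> cf cg x; apply: continuousM; [exact: cf|exact: cg].
have cc (r : R) : continuous (fun _ : Rheis R * Rheis R => r).
  exact: cst_continuous.
(* This is 2k times the z coordinate of [l], with its planar part replaced by the difference of the
   two planar parts; the products of coordinates of the first point alone cancel. *)
pose fz (pq : Rheis R * Rheis R) := (pq.2.2.2 - pq.1.2.2
  - 2^-1 * (pq.2.2.1 0 0 * pq.1.2.1 1 0 - pq.1.2.1 0 0 * pq.2.2.1 1 0))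
  * (2 * k)%:R.
rewrite (_ : Lambda_graph =
  [set pq : Rheis R * Rheis R | (pq.2.1 - pq.1.1) / (2 * pi) \is a Num.int] `&`
  [set pq : Rheis R * Rheis R | pq.2.2.1 0 0 - pq.1.2.1 0 0 \is a Num.int] `&`
  [set pq : Rheis R * Rheis R | pq.2.2.1 1 0 - pq.1.2.1 1 0 \is a Num.int] `&`
  [set pq : Rheis R * Rheis R | fz pq \is a Num.int]).
  apply: closedI; first apply: closedI; first apply: closedI; apply: pre.
  - exact: (cM _ _ (cB _ _ t2 t1) (cc _)).
  - exact: cB.
  - exact: cB.
  - apply: (cM); last exact: cc.
    apply: (cB); first exact: cB.
    by apply: (cM); [exact: cc|apply: cB; exact: cM].
apply/seteqP; split=> -[p q] /=.
  move=> [l [[m lm] [a [b [c [la lb lc]]]]] /= ->].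
  rewrite /fz /= !mxE la lb lc lm.
  split; first split; first split.
  - by rewrite addrK mulrC mulKf // intr_int.
  - by rewrite addrK intr_int.
  - by rewrite addrK intr_int.
  - apply/intrP; by exists c; field; rewrite pnatr_eq0 -lt0n.
move=> [[[/intrP[m mE] /intrP[a aE]] /intrP[b bE]] /intrP[c]].
rewrite /fz /= => cE.
exists (Lambda_point m a b c); first exact: Lambda_pointP.
have [lt lx ly lz] := Rheis_mulE (Lambda_point m a b c) p.
apply: Rheis_eq; rewrite ?lt ?lx ?ly ?lz /= ?mxE /= -?mE -?aE -?bE -?cE.
- by rewrite mulrC divfK // subrK.
- by rewrite subrK.
- by rewrite subrK.
- by field; rewrite pnatr_eq0 -lt0n.
Qed.

(** If [p] and [q] are inequivalent, the closed graph misses some A x B around them. The images of A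
    and B are neighbourhoods, and a common point of these would put an equivalent pair in A x B. *)
Lemma nil_hausdorff : hausdorff_space (nilmanifold R hk).
Proof.
move=> x y; have [p <-] := nil_proj_surj x; have [q <-] := nil_proj_surj y.
move=> clxy; apply: contrapT => pq.
have : nbhs (p, q) (~` Lambda_graph).
  apply: open_nbhs_nbhs; split.
    by rewrite openC; exact: Lambda_graph_closed.
  by move=> /(nil_projP hk p q).2.
move=> [[A B] /= [nA nB] AB].
have [_ [[a Aa <-] [b Bb /esym/nil_projP baE]]] :=
  clxy _ _ (nil_proj_nbhs hk nA) (nil_proj_nbhs hk nB).
exact: (AB (a, b)).
Qed.

(** A nonzero integer has absolute value at least 1. It is used with [c] equal to 2 pi for t and to
    1 for the other coordinates. *)
Lemma int_small (m : int) (c : R) : 1 <= c -> `|c * m%:~R| < 1 -> m = 0.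
Proof.
move=> c1 cm; apply: contraTeq cm => m0; rewrite -leNgt normrM.
rewrite (le_trans c1) // (le_trans (ler_norm c)) // ler_peMr //.
by apply: norm_intr_ge1; rewrite ?intr_int // intr_eq0.
Qed.

(* The radius 1/(4k) is half the smallest translation length 1/(2k) in z. *)
Lemma nil_proj_inj_ball (u0 u u' : 'rV[R]_4) (e := (4 * k)%:R^-1 : R) :
  ball u0 e u -> ball u0 e u' ->
  proj (Rheis_point u) = proj (Rheis_point u') -> u = u'.
Proof.
move=> [_ uu0] [_ uu0'] /nil_projP[l [[m lm] [a [b [c [la lb lc]]]]] uE].
have d i : `|u' 0 i - u 0 i| < 2 * e.
  have := uu0 0 i; have := uu0' 0 i.
  rewrite /ball /= !ltr_norml => /andP[? ?] /andP[? ?]; apply/andP; split; lra.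
have k0 : 0 < (4 * k)%:R :> R by rewrite ltr0n muln_gt0.
have e1 : 2 * e * (2 * k)%:R = 1.
  by rewrite /e !natrM; field; rewrite pnatr_eq0 -lt0n.
have e2 : 2 * e <= 1.
  have : 1 <= (2 * k)%:R :> R by rewrite ler1n muln_gt0.
  have : 0 < e by rewrite invr_gt0.
  nra.
have [lt lx ly lz] := Rheis_mulE l (Rheis_point u).
have [Et Ex Ey Ez] := Rheis_coordsE (l * Rheis_point u)%g.
rewrite lt -uE Rheis_pointK /= in Et.
rewrite lx -uE Rheis_pointK [(Rheis_point u).2.1 0 0]mxE /= in Ex.
rewrite ly -uE Rheis_pointK [(Rheis_point u).2.1 1 0]mxE /= in Ey.
rewrite lz -uE Rheis_pointK [(Rheis_point u).2.1 0 0]mxE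
  [(Rheis_point u).2.1 1 0]mxE /= in Ez.
have m0 : m = 0.
  apply: (@int_small _ (2 * pi)); first by have := pi_ge2 R; lra.
  by rewrite -lm; have := lt_le_trans (d 0) e2; rewrite Et addrK.
have a0 : a = 0.
  apply: (@int_small _ 1) => //.
  by rewrite mul1r -la; have := lt_le_trans (d 1) e2; rewrite Ex addrK.
have b0 : b = 0.
  apply: (@int_small _ 1) => //.
  by rewrite mul1r -lb; have := lt_le_trans (d 2) e2; rewrite Ey addrK.
have c0 : c = 0.
  apply: (@int_small _ 1) => //; rewrite mul1r.
  (* With [a] and [b] zero the symplectic term vanishes, so z moves by exactly c/(2k), which is less
     than 2e = 1/(2k) in absolute value. *)
  have := d 3; rewrite Ez la lb a0 b0 lc mul0r mulr0 subr0 mulr0 addr0 addrK.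
  rewrite normrM normfV (@ger0_norm _ (2 * k)%:R) // ltr_pdivrMr ?e1 //.
  by rewrite ltr0n muln_gt0.
apply/rowP; elim/ord4_ind.
- by rewrite Et lm m0 mulr0 add0r.
- by rewrite Ex la a0 add0r.
- by rewrite Ey lb b0 add0r.
- by rewrite Ez la lb lc a0 b0 c0 !mul0r mulr0 subr0 mulr0 add0r addr0.
Qed.

(** The chart inverts the projection on a coordinate ball small enough for [nil_proj_inj_ball]. *)
Lemma nil_chart_at q : exists2 a, atlas a & chart_dom a q.
Proof.
have [p <-] := nil_proj_surj q.
pose e : R := (4 * k)%:R^-1.
have e0 : 0 < e by rewrite invr_gt0 ltr0n muln_gt0.
pose U := ball (Rheis_coords p) e.
have oU : open U by exact: ball_open.
pose D := proj @` (@Rheis_coords R @^-1` U).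
have oD : open D.
  apply: nil_proj_open; apply: open_comp => // ? _.
  exact: Rheis_coords_continuous.
(* The section picks the preimage in the ball, unique by injectivity; outside [D] it takes the
   default value 0. *)
pose f (q : nilmanifold R hk) :=
  xget 0 [set u | U u /\ proj (Rheis_point u) = q].
have fK u : U u -> f (proj (Rheis_point u)) = u.
  move=> Uu; rewrite /f.
  case: xgetP => [u' _ [Uu' pE]|/(_ u)]; last by case.
  exact: (nil_proj_inj_ball Uu' Uu).
have imgE : f @` D = U.
  apply/seteqP; split=> [_ [_ [r Ur <-] <-]|u Uu].
    by rewrite -(Rheis_coordsK r) fK.
  exists (proj (Rheis_point u)); last exact: fK.
  by exists (Rheis_point u) => //=; rewrite Rheis_pointK.
exists (Chart D f (proj \o @Rheis_point R)); last first.
  by exists p => //=; exact: ballxx.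
split=> //; split=> //=.
- by rewrite /chart_img /= imgE.
- by move=> _ [r Ur <-]; rewrite -{1}(Rheis_coordsK r) fK //= Rheis_coordsK.
- rewrite continuous_open_subspace // => _ /set_mem[r Ur <-] W.
  rewrite -{1}(Rheis_coordsK r) fK // => nW.
  have nUW : nbhs (Rheis_coords r) (U `&` W).
    by apply: filterI => //; apply: open_nbhs_nbhs.
  (* Continuity of the section is openness of the projection: the image of the part of the ball
     lying in [W] is a neighbourhood that [f] maps into [W]. *)
  have := nil_proj_nbhs hk (Rheis_coords_continuous nUW).
  apply: filterS => _ [r' [Ur' Wr'] <-].
  by rewrite /= -(Rheis_coordsK r') fK.
- apply: continuous_subspaceT => u; apply: continuous_comp.
    exact: Rheis_point_continuous.
  exact: nil_proj_continuous.
Qed.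

(** Transition maps are the local expressions of the identity, that is of [nil_act] at the neutral
    element. *)
Lemma nil_smooth_atlas : smooth_atlas atlas.
Proof.
split=> [a []//|q|]; first exact: nil_chart_at.
rewrite -(nil_act1 hk); exact: smooth_map_nil_act.
Qed.

End Lattice.

Theorem proposition2p1 (R : realType) (k : nat) (hk : (0 < k)%N) :
  (is_left_action (@heis_act R) /\
   smooth_map (prod_atlas (heis_atlas R) (Rheis_atlas R)) (Rheis_atlas R)
     (fun hp => heis_act hp.1 hp.2)) /\
  [/\ compact [set: nilmanifold R hk],
      hausdorff_space (nilmanifold R hk),
      smooth_atlas (nil_atlas R hk),
      lorentz_metric (nil_atlas R hk) (nil_metric R hk) &
      is_local_isometry (Rheis_atlas R) (Rheis_metric R)
        (nil_atlas R hk) (nil_metric R hk) (nil_proj R hk)] /\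
  exists rho : heis R -> nilmanifold R hk -> nilmanifold R hk,
    [/\ forall h p, rho h (nil_proj R hk p) = nil_proj R hk (heis_act h p),
        is_left_action rho,
        smooth_map (prod_atlas (heis_atlas R) (nil_atlas R hk))
          (nil_atlas R hk) (fun hq => rho hq.1 hq.2) &
        forall h, is_isometry (nil_atlas R hk) (nil_metric R hk)
          (nil_atlas R hk) (nil_metric R hk) (rho h)].
Proof.
split; first by split; [exact: heis_act_is_action|exact: smooth_map_heis_act].
split.
  split; [exact: nil_compact|exact: nil_hausdorff|exact: nil_smooth_atlas|
    exact: nil_lorentz_metric|exact: nil_proj_local_isometry].
exists (@nil_act R k hk); split; [exact: nil_actE|exact: nil_act_is_action|
  exact: smooth_map_prod_nil_act|exact: is_isometry_nil_act].
Qed.
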